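(* For integers $n\geq 3$, $m\geq 2$ let $S^t(n,2m)$, $S^c(n,2m)$, $S^f(n,2m)$ be the $3^3.4^2$ lattices with toroidal, cylindrical and free boundary conditions defined below, and let $R(x,y)=\sqrt{3+2\cos x+2\cos y+2\cos(x+y)}$. Then, as $n$ and $m$ both tend to infinity, $$\lim_{n,m\rightarrow \infty}\frac{\mathcal E(S^t(n,2m))}{2nm}=\lim_{n,m\rightarrow \infty}\frac{\mathcal E(S^c(n,2m))}{2nm}=\lim_{n,m\rightarrow \infty}\frac{\mathcal E(S^f(n,2m))}{2nm}$$ $$=\frac{1}{8\pi^2}\int_0^{2\pi}\int_0^{2\pi}\Big(|2\cos x+R(x,y)|+|2\cos x-R(x,y)|\Big)\,dx\,dy .$$
   Context: For a finite simple graph $G$ with adjacency matrix $A(G)$, the energy $\mathcal E(G)$ is the sum of the absolute values of all eigenvalues of $A(G)$ (counted with multiplicity). All three graphs have vertex set $\{0,\dots,n-1\}\times\{0,\dots,2m-1\}$ ($2nm$ vertices). The toroidal $3^3.4^2$ lattice $S^t(n,2m)$ (a $2m\times n$ toroidal square lattice with a diagonal added in each square of every other row) has edges: $(i,j)\sim(i,j+1 \bmod 2m)$ for all $i,j$; $(i,j)\sim(i+1\bmod n,j)$ for all $i,j$; and $(i,2k+1)\sim(i+1\bmod n,2k)$ for all $i$ and $0\le k\le m-1$. The cylindrical lattice $S^c(n,2m)$ is obtained from $S^t(n,2m)$ by deleting the $n$ edges $(i,2m-1)\sim(i,0)$, $0\le i\le n-1$. The free lattice $S^f(n,2m)$ is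 obtained from $S^c(n,2m)$ by further deleting all edges joining a vertex $(n-1,j)$ to a vertex $(0,j')$. The limit $n,m\to\infty$ is the joint limit. *)

(* Defs.v *)
From HB Require Import structures.
From mathcomp Require Import all_boot all_order all_algebra.
From mathcomp Require Import complex.
From mathcomp Require Import all_classical all_reals all_analysis.

Set Implicit Arguments.
Unset Strict Implicit.
Unset Printing Implicit Defensive.

Import Order.TTheory GRing.Theory Num.Theory.
Import numFieldNormedType.Exports.

Local Open Scope ring_scope.

(** A graph is given by the adjacency relation on its finite vertex type. *)

Definition adjmx (K : nzRingType) (T : finType) (e : rel T) : 'M[K]_#|T| :=
  \matrix_(i, j) (e (enum_val i) (enum_val j))%:R.

(* The roots of the characteristic polynomial, each listed as many times as
   its algebraic multiplicity. *)
Definition eigenvalues (F : closedFieldType) n (A : 'M[F]_n) : seq F :=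
  sval (closed_field_poly_normal (char_poly A)).

Definition energy (R : rcfType) (T : finType) (e : rel T) : R :=
  \sum_(z <- eigenvalues (adjmx R[i] e)) ComplexField.Normc.normc z.

(* These are the intended simple graphs for n >= 3 and m >= 2; smaller values
   are irrelevant to the limit n, m -> oo. *)
Section Lattices.
Variables n m : nat.

Definition vertex : finType := ('I_n * 'I_(2 * m))%type.

Implicit Types u v : vertex.

(* [ordS] is the cyclic successor: +1 mod n on 'I_n, +1 mod 2m on 'I_(2 * m). *)
Definition vertical u v := (v.1 == u.1) && (v.2 == ordS u.2).
Definition horizontal u v := (v.1 == ordS u.1) && (v.2 == u.2).
Definition diagonal u v :=
  (v.1 == ordS u.1) &&
  [exists k : 'I_m, (u.2 == 2 * k + 1 :> nat)%N && (v.2 == 2 * k :> nat)%N].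

Definition arc u v := [|| vertical u v, horizontal u v | diagonal u v].

Definition toroidal_lattice : rel vertex := fun u v => arc u v || arc v u.

(* The edges (i, 2m-1) ~ (i, 0). *)
Definition row_wrap u v :=
  [&& v.1 == u.1, u.2 == (2 * m).-1 :> nat & v.2 == 0 :> nat].

Definition cylindrical_lattice : rel vertex :=
  fun u v => toroidal_lattice u v && ~~ (row_wrap u v || row_wrap v u).

Definition col_wrap u v := (u.1 == n.-1 :> nat) && (v.1 == 0 :> nat).

Definition free_lattice : rel vertex :=
  fun u v => cylindrical_lattice u v && ~~ (col_wrap u v || col_wrap v u).

Lemma toroidal_lattice_sym : symmetric toroidal_lattice.
Proof. by move=> u v; rewrite /toroidal_lattice orbC. Qed.

Lemma cylindrical_lattice_sym : symmetric cylindrical_lattice.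
Proof. by move=> u v; rewrite /cylindrical_lattice toroidal_lattice_sym orbC. Qed.

Lemma free_lattice_sym : symmetric free_lattice.
Proof. by move=> u v; rewrite /free_lattice cylindrical_lattice_sym orbC. Qed.

Lemma ordS_neq k (i : 'I_k) : (1 < k)%N -> (i == ordS i) = false.
Proof.
move=> k1; apply/negP => /eqP/(congr1 val) /= ii.
have := ltn_ord i; rewrite leq_eqVlt => /orP[/eqP ik|ik].
  by move: ii; rewrite ik modnn => i0; move: k1; rewrite -ik i0.
by move: ii; rewrite modn_small// => /eqP; rewrite -[X in X == _]addn0 -addn1 eqn_add2l.
Qed.

Lemma toroidal_lattice_irr : (1 < n)%N -> (0 < m)%N -> irreflexive toroidal_lattice.
Proof.
move=> n1 m0 u; have m1 : (1 < 2 * m)%N by rewrite mul2n -addnn (leq_add m0 m0).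
by rewrite /toroidal_lattice orbb /arc /vertical /horizontal /diagonal !ordS_neq ?andbF.
Qed.

Lemma cylindrical_lattice_irr : (1 < n)%N -> (0 < m)%N -> irreflexive cylindrical_lattice.
Proof. by move=> n1 m0 u; rewrite /cylindrical_lattice toroidal_lattice_irr. Qed.

Lemma free_lattice_irr : (1 < n)%N -> (0 < m)%N -> irreflexive free_lattice.
Proof. by move=> n1 m0 u; rewrite /free_lattice cylindrical_lattice_irr. Qed.

End Lattices.

Definition Rxy (R : realType) (x y : R) : R :=
  Num.sqrt (3 + 2 * cos x + 2 * cos y + 2 * cos (x + y)).

(* Main.v *)
(* The torus is invariant under translations by one column and by two rows, so
   plane waves block-diagonalise its adjacency matrix into 2 x 2 blocks
   [[2 cos a, c^*], [c, 2 cos a]] with c = 1 + e^(-ib) + e^(ia) and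
   |c| = Rxy a b, where (a, b) runs over the dual grid of (Z/n) x (Z/m).  The
   eigenvalues are 2 cos a +- |c|, and the energy per vertex is a Riemann sum of
   the integrand.  For normal matrices the sum of the moduli of the eigenvalues
   is the maximum of |tr (U A)| over unitary U; since the entries of U have
   modulus at most 1, deleting edges changes the energy by at most twice their
   number, here O(n + m), which is negligible against 2nm. *)

Require Import Defs.
From mathcomp Require Import all_boot all_order all_algebra.
From mathcomp Require Import complex ring lra zify.
From mathcomp Require Import all_classical all_reals all_analysis.
Import Order.TTheory GRing.Theory Num.Theory.
Import numFieldNormedType.Exports.
Local Open Scope classical_set_scope.
Local Open Scope ring_scope.

Set Implicit Arguments.
Unset Strict Implicit.
Unset Printing Implicit Defensive.

(** * Trace norm and energy *)

(** Both characteristic matrices are intertwined by [P] over the polynomial ring, and its nonzero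
    determinant cancels. *)
Lemma char_poly_similar (F : fieldType) n (P A B : 'M[F]_n) :
  P \in unitmx -> P *m A = B *m P -> char_poly A = char_poly B.
Proof.
move=> Pu PA; have detP : \det (map_mx polyC P) != 0.
  by rewrite det_map_mx polyC_eq0 -unitfE -unitmxE.
apply: (mulfI detP); rewrite /char_poly -det_mulmx [RHS]mulrC -det_mulmx.
congr (\det _); rewrite /char_poly_mx mulmxBr mulmxBl -!map_mxM PA.
by rewrite scalar_mxC.
Qed.

(** The list [eigenvalues A] is some chosen factorisation of the characteristic polynomial, so
    unique factorisation determines it only up to order. *)
Lemma eigenvalues_diag (C : closedFieldType) n (P A : 'M[C]_n) (d : 'rV[C]_n) :
  P \in unitmx -> P *m A = diag_mx d *m P ->
  perm_eq (eigenvalues A) [seq d 0 i | i <- enum 'I_n].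
Proof.
move=> Pu PA; rewrite /eigenvalues; case: closed_field_poly_normal => s /= As.
have /monicP Amonic := char_poly_monic A.
move: As; rewrite Amonic scale1r (char_poly_similar Pu PA) => As.
apply: prod_XsubC_eq; rewrite -As char_poly_trig; last first.
  by apply/is_trig_mxP => i j ij; rewrite mxE; case: eqP ij => // ->; rewrite ltnn.
rewrite big_map big_enum /=; apply: eq_bigr => i _.
by rewrite mxE eqxx mulr1n.
Qed.

Section TraceNorm.
Local Open Scope sesquilinear_scope.
Variable C : numClosedFieldType.

(* This is the usual trace norm only for normal matrices. *)
Definition trace_norm n (A : 'M[C]_n) : C := \sum_(z <- eigenvalues A) `|z|.

Lemma trace_norm_diag n (P A : 'M[C]_n) (d : 'rV[C]_n) :
  P \in unitmx -> P *m A = diag_mx d *m P ->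
  trace_norm A = \sum_i `|d 0 i|.
Proof.
move=> Pu PA; rewrite /trace_norm (perm_big _ (eigenvalues_diag Pu PA)).
by rewrite big_map big_enum.
Qed.

Lemma normal_diag n (A : 'M[C]_n) : A \is normalmx ->
  exists (P : 'M[C]_n) (d : 'rV[C]_n), [/\ P \is unitarymx, A = P^t* *m diag_mx d *m P &
    trace_norm A = \sum_i `|d 0 i|].
Proof.
move=> /orthomx_spectralP AE.
exists (spectralmx A), (spectral_diag A).
have U := spectral_unitarymx A.
split => //; first by rewrite -invmx_unitary.
apply: (trace_norm_diag (spectral_unit A)).
by rewrite {2}AE !mulmxA mulmxV ?mul1mx// spectral_unit.
Qed.

(** The squared moduli along a row of [U] sum to 1, and [U i j] contributes one of the terms. *)
Lemma unitarymx_norm_le1 n (U : 'M[C]_n) i j : U \is unitarymx -> `|U i j| <= 1.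
Proof.
move=> /unitarymxP/matrixP/(_ i i); rewrite !mxE eqxx => UE.
rewrite -(@ler_pXn2r _ 2)// ?nnegrE// expr1n -[leRHS]UE (bigD1 j)//=.
rewrite !mxE normCK lerDl sumr_ge0// => k _.
by rewrite !mxE mul_conjC_ge0.
Qed.

Lemma mxtrace_diagr n (M : 'M[C]_n) (d : 'rV[C]_n) :
  \tr (M *m diag_mx d) = \sum_i M i i * d 0 i.
Proof.
apply: eq_bigr => i _; rewrite mxE (bigD1 i)//= mxE eqxx mulr1n big1 ?addr0//.
by move=> j ji; rewrite mxE (negbTE ji) mulr0n mulr0.
Qed.

(** Diagonalising [A] and using cyclicity, the trace becomes the sum of the eigenvalues weighted by
    the diagonal entries of a unitary matrix. *)
Lemma norm_mxtrace_unitary n (U A : 'M[C]_n) :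
  U \is unitarymx -> A \is normalmx -> `|\tr (U *m A)| <= trace_norm A.
Proof.
move=> Uu /normal_diag[P [d [Pu -> ->]]].
rewrite !mulmxA mxtrace_mulC !mulmxA mxtrace_diagr.
have PUP : P *m U *m P^t* \is unitarymx.
  by rewrite !mul_unitarymx// trmxC_unitary.
apply: le_trans (ler_norm_sum _ _ _) _; apply: ler_sum => i _.
by rewrite normrM ler_piMl// unitarymx_norm_le1.
Qed.

(** The maximiser acts in the eigenbasis of [A] and multiplies each eigenvalue by its conjugate
    phase. *)
Lemma trace_norm_attained n (A : 'M[C]_n) : A \is normalmx ->
  exists2 U, U \is unitarymx & trace_norm A = \tr (U *m A).
Proof.
move=> /normal_diag[P [d [Pu -> ->]]].
(* The value 1 at a zero eigenvalue keeps every [s i] of modulus one. *)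
pose s i := if d 0 i == 0 then 1 else (d 0 i)^* / `|d 0 i|.
have sn i : s i * (s i)^* = 1.
  rewrite -normCK /s; case: eqVneq => d0; first by rewrite normr1 expr1n.
  by rewrite normf_div norm_conjC normr_id divff ?expr1n// normr_eq0.
exists (P^t* *m diag_mx (\row_i s i) *m P).
  rewrite !mul_unitarymx// ?trmxC_unitary//.
  apply/unitarymxP; rewrite tr_diag_mx map_diag_mx mulmx_diag.
  by rewrite -diag_const_mx; congr diag_mx; apply/rowP => i; rewrite !mxE.
rewrite -!mulmxA mxtrace_mulC -!mulmxA.
rewrite [P *m (P^t* *m _)]mulmxA (unitarymxP Pu) mul1mx mulmx1 mxtrace_diagr.
apply: eq_bigr => i _; rewrite !mxE eqxx mulr1n /s; case: eqVneq => [->|d0].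
  by rewrite normr0 mulr0.
by rewrite mulrAC [_^* * _]mulrC -normCK expr2 mulfK// normr_eq0.
Qed.

(* Apply the unitary that attains the trace norm of A to A = B + (A - B). *)
Lemma trace_norm_lip n (A B : 'M[C]_n) : A \is normalmx -> B \is normalmx ->
  trace_norm A <= trace_norm B + \sum_i \sum_j `|A i j - B i j|.
Proof.
move=> An Bn; have [U Uu AE] := trace_norm_attained An.
have -> : trace_norm A = `|\tr (U *m B) + \tr (U *m (A - B))|.
  rewrite -mxtraceD -mulmxDr addrC subrK -AE ger0_norm//.
  by apply: sumr_ge0 => z _.
apply: le_trans (ler_normD _ _) _.
rewrite lerD ?norm_mxtrace_unitary//.
apply: le_trans (ler_norm_sum _ _ _) _; rewrite exchange_big/=.
apply: ler_sum => i _; rewrite mxE; apply: le_trans (ler_norm_sum _ _ _) _.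
by apply: ler_sum => j _; rewrite normrM !mxE ler_piMl// unitarymx_norm_le1.
Qed.

End TraceNorm.

(** * Graph energy: edge deletion and explicit eigenbases *)

Section Energy.
Variable R : rcfType.
Local Open Scope complex_scope.

Lemma energyE (T : finType) (e : rel T) :
  (energy R e)%:C = trace_norm (adjmx R[i] e).
Proof. by rewrite /energy /trace_norm rmorph_sum. Qed.

Lemma sum_enum_val (V : nmodType) (T : finType) (F : T -> V) :
  \sum_(i < #|T|) F (enum_val i) = \sum_x F x.
Proof. by rewrite -big_enum_val. Qed.

Lemma adjmx_normal (T : finType) (e : rel T) :
  symmetric e -> adjmx R[i] e \is normalmx.
Proof.
move=> e_sym; apply: symmetric_normalmx.
  by apply/is_hermitianmxP; rewrite expr0 scale1r; apply/matrixP => i j; rewrite !mxE e_sym.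
by apply/mxOverP => i j; rewrite mxE realn.
Qed.

(* Each deleted edge is counted twice, once per orientation. *)
Lemma energy_lip (T : finType) (e f : rel T) : symmetric e -> symmetric f ->
  subrel f e ->
  `|energy R e - energy R f| <= (\sum_x \sum_y (e x y && ~~ f x y))%:R.
Proof.
move=> es fs fe.
(* The hypothesis on [a] and [b] is symmetric in them, so this one-sided bound serves for both
   directions. *)
have D (a b : rel T) : symmetric a -> symmetric b ->
    (forall x y, `|(a x y)%:R - (b x y)%:R| = (e x y && ~~ f x y)%:R :> R[i]) ->
    energy R a <= energy R b + (\sum_x \sum_y (e x y && ~~ f x y))%:R.
  move=> sa sb ab; rewrite -lecR rmorphD/= !energyE.
  apply: le_trans (trace_norm_lip (adjmx_normal sa) (adjmx_normal sb)) _.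
  rewrite lerD2l rmorph_nat natr_sum -[leRHS]sum_enum_val; apply: ler_sum => i _.
  rewrite natr_sum -[leRHS]sum_enum_val; apply: ler_sum => j _.
  by rewrite !mxE ab.
rewrite ler_distl lerBlDr; apply/andP; split; apply: D => // x y;
  have := fe x y; case: (e x y) (f x y) => -[]//= H;
  rewrite ?subrr ?subr0 ?sub0r ?normrN ?normr0 ?normr1//;
  by have := H isT.
Qed.

(** Biorthogonality makes [G], divided by [c], the inverse of the matrix of [F]; the left
    eigenvectors [F p] therefore diagonalise the adjacency matrix. *)
Lemma energy_eigenvectors (T : finType) (e : rel T)
    (F G : T -> T -> R[i]) (lam : T -> R) (c : R[i]) : c != 0 ->
  (forall p q, \sum_x F p x * G q x = c *+ (p == q)) ->
  (forall p x, \sum_y F p y * (e y x)%:R = (lam p)%:C * F p x) ->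
  energy R e = \sum_p `|lam p|.
Proof.
move=> c0 FG Fe; apply: complexI; rewrite energyE rmorph_sum.
pose P : 'M[R[i]]_#|T| := \matrix_(i, j) F (enum_val i) (enum_val j).
pose Q : 'M[R[i]]_#|T| := \matrix_(i, j) G (enum_val j) (enum_val i).
have PQ : P *m (c^-1 *: Q) = 1%:M.
  rewrite -scalemxAr; apply/matrixP => i j; rewrite !mxE.
  under eq_bigr do rewrite !mxE.
  rewrite (sum_enum_val (fun x => F _ x * G _ x)) FG (inj_eq enum_val_inj).
  by case: eqP => _; rewrite ?mulr1n ?mulVf// mulr0.
rewrite (@trace_norm_diag _ _ P _ (\row_i (lam (enum_val i))%:C)).
- rewrite -[RHS]sum_enum_val; apply: eq_bigr => i _; rewrite mxE normc_def/=.
  by rewrite expr0n addr0 sqrtr_sqr.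
- by have [] := mulmx1_unit PQ.
- apply/matrixP => i j; rewrite mul_diag_mx !mxE.
  under eq_bigr do rewrite !mxE.
  by rewrite (sum_enum_val (fun y => F _ y * (e y _)%:R)) Fe.
Qed.

End Energy.

(** * Riemann sums *)

Section RiemannSums.
Variable R : realType.
Notation mu := (@lebesgue_measure R).

Lemma continuous_itv_integrable (f : R -> R) (a b : R) (x y : bool) :
  continuous f ->
  mu.-integrable [set` Interval (BSide x a) (BSide y b)] (EFin \o f).
Proof.
move=> fc; have := @continuous_compact_integrable R f `[a, b]%classic.
move=> /(_ (@segment_compact R a b))/(_ (continuous_subspaceT fc)).
apply: integrableS => //=.
by apply: subset_itv; case: x y => -[]; rewrite bnd_simp.
Qed.

Lemma dist_Rintegral_le (f g : R -> R) (a b e : R) :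
  a <= b -> continuous f -> continuous g -> (forall x, a <= x <= b -> `|f x - g x| <= e) ->
  `|\int[mu]_(x in `[a, b]) f x - \int[mu]_(x in `[a, b]) g x| <= (b - a) * e.
Proof.
move=> ab fc gc fg; have fgc : continuous (fun x => f x - g x).
  by move=> x; apply: continuousB; [exact: fc|exact: gc].
have nc : continuous (fun x => `|f x - g x|).
  by move=> x; apply: cvg_norm; exact: fgc.
rewrite -RintegralB//; try exact: continuous_itv_integrable.
apply: le_trans (le_normr_Rintegral _ _) _ => //.
  exact: continuous_itv_integrable.
have <- : \int[mu]_(x in `[a, b]) e = (b - a) * e.
  rewrite Rintegral_cst//= lebesgue_measure_itv/= lte_fin mulrC.
  by rewrite lt_neqAle ab andbT; case: eqVneq => [->|_]/=; rewrite ?subrr.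
apply: le_Rintegral => //; try exact: continuous_itv_integrable.
by apply: continuous_itv_integrable; exact: cst_continuous.
Qed.

(** Induction on the number of cells: on each new cell [f] is compared with its value at the left
    endpoint, at a cost of at most [h * e]. *)
Lemma dist_Riemann_sum (f : R -> R) (h e : R) n :
  0 <= h -> continuous f ->
  (forall x y, `|x - y| <= h -> `|f x - f y| <= e) ->
  `|\int[mu]_(x in `[0, n%:R * h]) f x - h * \sum_(k < n) f (k%:R * h)|
  <= n%:R * h * e.
Proof.
move=> h0 fc fe; elim: n => [|n IHn].
  by rewrite big_ord0 !mul0r mulr0 subr0 set_itv1 Rintegral_set1 normr0.
have nhS : n.+1%:R * h = n%:R * h + h by rewrite -addn1 natrD mulrDl mul1r.
have nh : n%:R * h <= n.+1%:R * h by rewrite ler_wpM2r// ler_nat.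
have := @Rintegral_itvB R f (BLeft 0) (BRight (n.+1%:R * h)) (n%:R * h).
move=> /(_ (continuous_itv_integrable _ _ _ _ fc)).
rewrite !bnd_simp mulr_ge0// => /(_ isT nh).
rewrite Rintegral_itv_obnd_cbnd; last exact: continuous_itv_integrable.
move=> /eqP; rewrite subr_eq => /eqP ->.
have := @dist_Rintegral_le f (cst (f (n%:R * h))) _ _ e nh fc (@cst_continuous _ _ _).
rewrite /= Rintegral_cst//= lebesgue_measure_itv/= lte_fin.
have -> : n.+1%:R * h - n%:R * h = h by rewrite -mulrBl -natrB// subSnn mul1r.
have -> : fine (if n%:R * h < n.+1%:R * h then
    ((n.+1%:R * h)%:E - (n%:R * h)%:E)%E else 0%E) = h.
  (* The second case is a degenerate cell, which forces [h = 0]. *)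
  case: ltP => /= [_|hn]; first by rewrite -mulrBl -natrB// subSnn mul1r.
  by apply/le_anti; rewrite h0 -(lerD2l (n%:R * h)) addr0 -nhS.
move=> step; rewrite big_ord_recr/=.
have {}step : `|\int[mu]_(x in `[n%:R * h, n.+1%:R * h]) f x - h * f (n%:R * h)|
    <= h * e.
  rewrite [h * f _]mulrC; apply: step => x /andP[x1 x2]; apply: fe.
  by rewrite ger0_norm ?subr_ge0// lerBlDl -nhS.
rewrite nhS in step *.
rewrite [X in `|X - _|]addrC mulrDr opprD addrACA [leRHS]mulrDl.
exact: le_trans (ler_normD _ _) (lerD IHn step).
Qed.

(** The one-dimensional estimate is applied twice: to the inner integral as a function of [y], then
    to each horizontal slice. *)
Lemma dist_double_Riemann_sum (g : R -> R -> R) (L : R) :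
  0 < L ->
  (forall e : R, 0 < e -> exists2 d : R, 0 < d & forall x y x' y',
    `|x - x'| <= d -> `|y - y'| <= d -> `|g x y - g x' y'| <= e) ->
  forall e : R, 0 < e -> exists N, forall n m, (N <= n)%N -> (N <= m)%N ->
    `|\int[mu]_(y in `[0, L]) \int[mu]_(x in `[0, L]) g x y -
      L / n%:R * (L / m%:R) *
      \sum_(k < n) \sum_(l < m) g (k%:R * (L / n%:R)) (l%:R * (L / m%:R))| <= e.
Proof.
(* Each of the two applications costs [L * (L * e1)], which is half of [e]. *)
move=> L0 gu e e0; pose e1 : R := e / (2 * L ^+ 2).
have e10 : 0 < e1 by rewrite divr_gt0// mulr_gt0// exprn_gt0.
have [d d0 gd] := gu _ e10.
have cont (f : R -> R) : (forall e : R, 0 < e -> exists2 d : R, 0 < d & forall x x',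
    `|x - x'| <= d -> `|f x - f x'| <= e) -> continuous f.
  move=> fu x; apply/cvgrPdist_le => r /fu[t t0 ft]; near=> y; apply: ft.
  by near: y; exact: cvgr_dist_le.
have gxc y : continuous (g ^~ y).
  apply: cont => r /gu[t t0 gt]; exists t => // x x' xx'.
  by apply: gt; rewrite // subrr normr0 ltW.
pose I y := \int[mu]_(x in `[0, L]) g x y.
have Id (r t : R) : (forall x y x' y', `|x - x'| <= t -> `|y - y'| <= t ->
    `|g x y - g x' y'| <= r) -> 0 < t -> forall y y', `|y - y'| <= t -> `|I y - I y'| <= L * r.
  move=> gt t0 y y' yy'; have := dist_Rintegral_le (ltW L0) (gxc y) (gxc y').
  by rewrite subr0; apply => x _; apply: gt; rewrite // subrr normr0 ltW.
have Ic : continuous I.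
  apply: cont => r r0; have [t t0 gt] := gu (r / L) (divr_gt0 r0 L0).
  exists t => // y y' yy'; have := Id _ _ gt t0 _ _ yy'.
  by rewrite mulrCA divff ?mulr1// gt_eqF.
have [N Nd] : exists N : nat, forall n, (N <= n)%N -> (0 < n)%N /\ L / n%:R <= d.
  exists (Num.truncn (L / d)).+1 => n Nn; have n0 : (0 < n)%N by apply: leq_trans Nn.
  split=> //; rewrite ler_pdivrMr ?ltr0n// mulrC -ler_pdivrMr//.
  by apply: le_trans (ltW (truncnS_gt _)) _; rewrite ler_nat.
exists N => n m /Nd[n0 nd] /Nd[m0 md].
set hn := L / n%:R; set hm := L / m%:R.
have hn0 : 0 <= hn by rewrite divr_ge0// ltW.
have hm0 : 0 <= hm by rewrite divr_ge0// ltW.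
have nhn : n%:R * hn = L by rewrite mulrC divfK// pnatr_eq0 -lt0n.
have mhm : m%:R * hm = L by rewrite mulrC divfK// pnatr_eq0 -lt0n.
have S1 : `|\int[mu]_(y in `[0, L]) I y - hm * \sum_(l < m) I (l%:R * hm)|
    <= L * (L * e1).
  rewrite -mhm; apply: dist_Riemann_sum => // y y' yy'; rewrite mhm.
  by apply: Id gd d0 _ _ _; exact: le_trans yy' _.
have S2 y : `|I y - hn * \sum_(k < n) g (k%:R * hn) y| <= L * e1.
  rewrite /I -nhn; apply: dist_Riemann_sum => // x x' xx'.
  by apply: gd; rewrite ?subrr ?normr0 ?(ltW d0)//; exact: le_trans xx' _.
have S3 : `|hm * \sum_(l < m) I (l%:R * hm) -
    hn * hm * \sum_(k < n) \sum_(l < m) g (k%:R * hn) (l%:R * hm)| <= L * (L * e1).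
  rewrite exchange_big/= (mulrC hn) -[hm * hn * _]mulrA -mulrBr mulr_sumr.
  rewrite -sumrB normrM ger0_norm//.
  have -> : L * (L * e1) = hm * (m%:R * (L * e1)) by rewrite [RHS]mulrA (mulrC hm) mhm.
  rewrite ler_wpM2l//.
  apply: le_trans (ler_norm_sum _ _ _) _.
  apply: le_trans (ler_sum _ (fun l _ => S2 _)) _.
  by rewrite sumr_const card_ord mulr_natl.
(* The intermediate quantity sums over [y] but still integrates exactly over [x]. *)
rewrite -(subrKA (hm * \sum_(l < m) I (l%:R * hm))).
apply: le_trans (ler_normD _ _) _; apply: le_trans (lerD S1 S3) _.
by rewrite /e1 le_eqVlt; apply/orP; left; apply/eqP; field; rewrite gt_eqF.
Unshelve. all: by end_near. Qed.

Lemma cos_lip (x y : R) : `|cos x - cos y| <= `|x - y|.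
Proof.
wlog xy : x y / x <= y.
  by case: (leP x y) => [|/ltW] xy H; [|rewrite distrC (distrC x)]; exact: H.
have [c _ E] := MVT_segment xy (fun z _ => is_derive_cos z)
  (continuous_subspaceT (@continuous_cos R)).
by rewrite distrC E normrM normrN (distrC x) ler_piMl// sin_max.
Qed.

(** The square root is Hölder of exponent 1/2 down to 0. This matters because the radicand of [Rxy]
    vanishes at some points, where no Lipschitz bound holds. *)
Lemma dist_sqrt_le (a b e : R) : 0 <= a -> 0 <= b -> 0 <= e ->
  `|a - b| <= e ^+ 2 -> `|Num.sqrt a - Num.sqrt b| <= e.
Proof.
have D u v : 0 <= v -> 0 <= e -> u <= v + e ^+ 2 ->
    Num.sqrt u <= Num.sqrt v + e.
  move=> v0 e0 uv; have s0 := sqrtr_ge0 v.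
  rewrite -[leRHS]ger0_norm ?addr_ge0// -sqrtr_sqr ler_wsqrtr//.
  apply: le_trans uv _; rewrite sqrrD sqr_sqrtr// -addrA lerD2l lerDr.
  by rewrite mulrn_wge0// mulr_ge0.
move=> a0 b0 e0; rewrite !ler_distl !lerBlDr => /andP[ba ab].
by apply/andP; split; apply: D.
Qed.

End RiemannSums.

(** * The toroidal lattice *)

Section Neighbours.
Variables n m : nat.
Hypotheses (n3 : (3 <= n)%N) (m2 : (2 <= m)%N).
Implicit Types u v : vertex n m.

(** Every vertex lies on exactly one diagonal, which leads down and forward from an odd row, up and
    backward from an even one. *)
Definition neighbours u : seq (vertex n m) :=
  [:: (u.1, ordS u.2); (u.1, ord_pred u.2); (ordS u.1, u.2); (ord_pred u.1, u.2);
      if odd u.2 then (ordS u.1, ord_pred u.2) else (ord_pred u.1, ordS u.2)].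

Lemma ordS_val k (i : 'I_k) :
  ordS i = (if i.+1 == k then 0 else i.+1)%N :> nat.
Proof.
rewrite /=; case: eqP => [->|/eqP ik]; first by rewrite modnn.
by rewrite modn_small// ltn_neqAle ik ltn_ord.
Qed.

Lemma ord_pred_val k (i : 'I_k) :
  ord_pred i = (if i == 0 :> nat then k.-1 else i.-1)%N :> nat.
Proof.
have ik := ltn_ord i; rewrite /=; case: eqP => [->|/eqP i0].
  by rewrite add0n modn_small// prednK//; apply: leq_trans ik.
have -> : ((i + k).-1 = i.-1 + k)%N by move: i0 ik; case: (nat_of_ord i).
by rewrite modnDr modn_small// (leq_ltn_trans (leq_pred _)).
Qed.

Lemma toroidal_lattice_neighbours u v :
  toroidal_lattice u v = (v \in neighbours u).
Proof.
case: u v => [i j] [i' j']; rewrite /toroidal_lattice /Defs.arc /vertical /horizontal.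
rewrite /Defs.diagonal /neighbours /=.
have E k (a b : 'I_k) : (b == ordS a) = (a == ord_pred b).
  by apply/eqP/eqP => ->; rewrite (ordSK, ord_predK).
(* The existential amounts to a parity condition with witness [a./2]; the predecessor of an odd row
   never wraps around. *)
have dE (a b : 'I_(2 * m)) :
    [exists k : 'I_m, (a == 2 * k + 1 :> nat)%N && (b == 2 * k :> nat)%N] =
    odd a && (b == ord_pred a).
  apply/existsP/andP => [[k /andP[/eqP ak /eqP bk]]|[oa /eqP ->]].
    rewrite ak; split; first by rewrite addn1/= mul2n odd_double.
    by apply/eqP/ord_inj; rewrite ord_pred_val ak bk addn1.
  have ha : (a./2 < m)%N by have := ltn_ord a; lia.
  exists (Ordinal ha); rewrite -[nat_of_ord (Ordinal ha)]/(a./2).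
  have aE : nat_of_ord a = (2 * a./2).+1.
    by have := odd_double_half a; rewrite oa -mul2n add1n.
  rewrite ord_pred_val; move: (nat_of_ord a) aE => x; move: x./2 => h ->.
  by rewrite addn1 !eqxx.
(* This is the diagonal seen from its even end; the successor of an even row never wraps, as [2 * m]
   is even. *)
have dE' : odd j' && (j == ord_pred j') = ~~ odd j && (j' == ordS j).
  rewrite -E; case: eqP => [->|]; last by rewrite !andbF.
  by rewrite !andbT ordS_val; have := ltn_ord j; case: eqP; lia.
rewrite !dE dE' -!E (E _ j' j) (E _ i' i) (eq_sym i i') (eq_sym j j') !inE.
case: ifP => oj; rewrite !xpair_eqE/=.
  by do 6 case: (_ == _).
by do 6 case: (_ == _).
Qed.

(** On a cycle of length at least 3, an index, its successor and its predecessor are pairwise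
    distinct; both [n] and [2 * m] are that large. *)
Lemma neighbours_uniq u : uniq (neighbours u).
Proof.
have D k (a : 'I_k) : (2 < k)%N ->
    [/\ (a == ordS a) = false, (a == ord_pred a) = false &
      (ordS a == ord_pred a) = false].
  move=> k2; have ak := ltn_ord a.
  split; apply/eqP => /(congr1 (@nat_of_ord k));
    rewrite ?ordS_val ?ord_pred_val; repeat case: eqP; lia.
case: u => i j; rewrite /neighbours /= !inE.
have [iS iP iSP] := D _ i n3.
have [jS jP jSP] : [/\ (j == ordS j) = false, (j == ord_pred j) = false &
      (ordS j == ord_pred j) = false] by apply: D; lia.
rewrite !xpair_eqE !(eq_sym (ordS j) j) !(eq_sym (ord_pred j) j).
by case: odd; rewrite !xpair_eqE !eqxx ?iS ?iP ?iSP ?jS ?jP ?jSP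
  ?(eq_sym (ord_pred i)) ?iSP ?(eq_sym (ord_pred j)) ?jP ?(eq_sym (ordS j)) ?jS.
Qed.

Lemma sum_toroidal (V : nmodType) (F : vertex n m -> V) u :
  \sum_(v | toroidal_lattice v u) F v = \sum_(v <- neighbours u) F v.
Proof.
rewrite big_uniq ?neighbours_uniq//; apply: eq_bigl => v.
by rewrite toroidal_lattice_sym toroidal_lattice_neighbours.
Qed.

End Neighbours.

(** * Roots of unity and the structure factor *)

Section Cis.
Variable R : realType.
Local Open Scope complex_scope.
Local Notation C := R[i].

Definition cis (t : R) : C := cos t +i* sin t.

Lemma cisD a b : cis (a + b) = cis a * cis b.
Proof. by rewrite /cis cosD sinD; simpc; congr Complex; rewrite addrC mulrC. Qed.

Lemma cis0 : cis 0 = 1.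
Proof. by rewrite /cis cos0 sin0. Qed.

Lemma cis_mulVN t : cis (- t) * cis t = 1.
Proof. by rewrite -cisD addNr cis0. Qed.

Lemma cis_neq0 t : cis t != 0.
Proof.
apply/eqP => c0; have := cis_mulVN t; rewrite c0 mulr0 => /eqP.
by rewrite eq_sym oner_eq0.
Qed.

Lemma cisN t : cis (- t) = (cis t)^-1.
Proof. by apply: (mulIf (cis_neq0 t)); rewrite cis_mulVN mulVf// cis_neq0. Qed.

Lemma cisX t n : cis (n%:R * t) = cis t ^+ n.
Proof.
by elim: n => [|n IHn]; rewrite ?mul0r ?cis0// exprS -IHn -cisD mulrS mulrDl mul1r.
Qed.

Lemma cis2pi : cis (2 * pi) = 1.
Proof. by rewrite /cis mulr_natl cos2pi sin2pi. Qed.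

Lemma cisDV t : cis t + (cis t)^-1 = (2 * cos t)%:C.
Proof.
rewrite -cisN /cis cosN sinN; apply/eqP; rewrite eq_complex/=.
by apply/andP; split; apply/eqP; ring.
Qed.

(** The real part is [1 - 2 * sin (t / 2) ^+ 2], and the sine is positive on this range. *)
Lemma cis_neq1 t : 0 < t < 2 * pi -> cis t != 1.
Proof.
move=> /andP[t0 tpi]; apply/negP => /eqP/(congr1 (@complex.Re R))/= cos1.
have st : 0 < sin (t / 2) by apply: sin_gt0_pi; rewrite divr_gt0//=; lra.
have : cos t = 1 - 2 * sin (t / 2) ^+ 2.
  rewrite [in LHS](_ : t = (t / 2) *+ 2); last by rewrite -mulr_natr divfK.
  by rewrite cos_mulr2n cos2sin2 -mulr_natl; ring.
by have := exprn_gt0 2 st; rewrite cos1; lra.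
Qed.

(** The product is arranged to match the sample points of the double Riemann sum with
    [L = 2 * pi]. *)
Definition rootangle N (k : nat) : R := k%:R * (2 * pi / N%:R).

Lemma cis_rootangleX N k : (0 < N)%N -> cis (rootangle N k) ^+ N = 1.
Proof.
move=> N0; rewrite -cisX mulrCA [N%:R * _]mulrC divfK ?pnatr_eq0 -?lt0n//.
by rewrite cisX cis2pi expr1n.
Qed.

(** Orthogonality of the characters of Z/N: off the diagonal this is a geometric sum whose ratio is
    an [N]-th root of unity other than 1. *)
Lemma sum_cis_rootangle N (k l : 'I_N) :
  \sum_(j < N) (cis (rootangle N k) / cis (rootangle N l)) ^+ j = (N%:R : C) *+ (k == l).
Proof.
have N0 : (0 < N)%N by apply: leq_ltn_trans (ltn_ord k).
case: eqVneq => [->|kl].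
  rewrite divff ?cis_neq0//; under eq_bigr do rewrite expr1n.
  by rewrite sumr_const card_ord.
set z := _ / _; have z1 : z != 1.
  (* Inverting [z] swaps [k] and [l]; once [l < k], the angle difference lies strictly between 0 and
     [2 * pi]. *)
  rewrite /z; wlog lk : k l kl @z / (l < k)%N.
    case: (ltngtP l k) => [lk|lk|/val_inj lk] H; first exact: H.
      rewrite -(inj_eq invr_inj) invf_div invr1; apply: H => //.
      by rewrite eq_sym.
    by rewrite lk eqxx in kl.
  rewrite -cisN -cisD cis_neq1// /rootangle -mulrBl -natrB 1?ltnW//.
  have kN : (k - l < N)%N by rewrite (leq_ltn_trans (leq_subr _ _)).
  have p0 := pi_gt0 R.
  rewrite mulr_gt0 ?ltr0n ?subn_gt0 ?divr_gt0 ?ltr0n ?mulr_gt0//=.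
  by rewrite mulrA ltr_pdivrMr ?ltr0n// mulrC ltr_pM2l ?mulr_gt0// ltr_nat.
rewrite -subr_eq0 in z1; apply: (mulfI z1); rewrite mulr0.
by rewrite -subrX1 /z expr_div_n !cis_rootangleX// divr1 subrr.
Qed.

(** The relation [z ^+ N = 1] absorbs the wrap-around of [ordS]. *)
Lemma unity_ordS N (z : C) (j : 'I_N) : z ^+ N = 1 -> z ^+ ordS j = z * z ^+ j.
Proof.
by move=> zN; rewrite ordS_val -exprS; case: eqP => [->|//]; rewrite zN.
Qed.

Lemma unity_ord_pred N (z : C) (j : 'I_N) : z != 0 -> z ^+ N = 1 ->
  z ^+ ord_pred j = z^-1 * z ^+ j.
Proof.
by move=> z0 zN; rewrite -[in RHS](ord_predK j) unity_ordS// mulrA mulVf// mul1r.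
Qed.

(* The value at 0 only has to be nonzero. *)
Definition phase (c : C) : C := if c == 0 then 1 else c / `|c|.

Lemma phase_neq0 c : phase c != 0.
Proof.
by rewrite /phase; case: ifPn => // c0; rewrite mulf_neq0// invr_eq0 normr_eq0.
Qed.

Lemma norm_phase c : `|c| * phase c = c.
Proof.
rewrite /phase; case: eqVneq => [->|c0]; first by rewrite normr0 mul0r.
by rewrite mulrCA divff ?mulr1// normr_eq0.
Qed.

Lemma phase_conj c : phase c * (c^*)%R = `|c|.
Proof.
rewrite /phase; case: eqVneq => [->|c0]; first by rewrite rmorph0 mulr0 normr0.
by rewrite mulrAC -normCK expr2 mulfK// normr_eq0.
Qed.

Lemma conj_cis t : ((cis t)^*)%R = (cis t)^-1.
Proof. by rewrite -cisN /cis cosN sinN. Qed.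

Lemma norm_structure_factor a b :
  `|1 + (cis b)^-1 + cis a| = (Rxy a b)%:C.
Proof.
have -> : 1 + (cis b)^-1 + cis a =
    (1 + cos b + cos a) +i* (sin a - sin b) :> R[i].
  rewrite -cisN /cis cosN sinN; apply/eqP; rewrite eq_complex/=.
  by apply/andP; split; apply/eqP; ring.
rewrite normc_def/= /Rxy cosD; congr ((Num.sqrt _)%:C).
by have := cos2Dsin2 a; have := cos2Dsin2 b; rewrite !expr2; lra.
Qed.

(** The radicand is the squared modulus of the structure factor, hence a sum of two squares. *)
Lemma radicand_ge0 (a b : R) : 0 <= 3 + 2 * cos a + 2 * cos b + 2 * cos (a + b).
Proof.
have -> : 3 + 2 * cos a + 2 * cos b + 2 * cos (a + b) =
    (1 + cos a + cos b) ^+ 2 + (sin a - sin b) ^+ 2.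
  by rewrite cosD; have := cos2Dsin2 a; have := cos2Dsin2 b; rewrite !expr2; lra.
by rewrite addr_ge0// sqr_ge0.
Qed.

End Cis.

(** Groups the rows into the pairs that form the unit cells. *)
Lemma sum_ord_double (V : nmodType) m (h : nat -> V) :
  \sum_(j < 2 * m) h j = \sum_(t < m) (h t.*2 + h t.*2.+1).
Proof.
rewrite mul2n; elim: m => [|m IHm]; first by rewrite !big_ord0.
by rewrite doubleS !big_ord_recr/= IHm addrA.
Qed.

(** * Plane waves on the torus and its spectrum *)

Section Fourier.
Variable R : realType.
Variables n m : nat.
Hypotheses (n3 : (3 <= n)%N) (m2 : (2 <= m)%N).
Local Open Scope complex_scope.
Local Notation C := R[i].
Implicit Types p q x : vertex n m.

Definition colfreq p : R := rootangle R n p.1.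
Definition rowfreq p : R := rootangle R m p.2./2.

(** The ratio of odd-row to even-row amplitude in an eigenvector of the 2 x 2 block: plus or minus
    [c / |c|], with the sign selecting the band. *)
Definition sublattice_phase p : C :=
  (-1) ^+ (p.2 : nat) * phase (1 + (cis (rowfreq p))^-1 + cis (colfreq p)).

(* A mode is indexed by a vertex (k, q): q./2 is the frequency along the m pairs
   of rows, the parity of q selects one of the two bands. *)
Definition mode p x : C :=
  cis (colfreq p) ^+ x.1 * (cis (rowfreq p))^-1 ^+ (x.2./2) *
  (if odd x.2 then sublattice_phase p else 1).

Lemma sublattice_phase_neq0 p : sublattice_phase p != 0.
Proof. by rewrite mulf_neq0 ?phase_neq0// signr_eq0. Qed.

Definition mode_eigenvalue p : R :=
  2 * cos (colfreq p) + (-1) ^+ (p.2 : nat) * Rxy (colfreq p) (rowfreq p).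

Lemma odd_ordS (j : 'I_(2 * m)) : odd (ordS j) = ~~ odd j.
Proof. by rewrite ordS_val; have := ltn_ord j; case: eqP; lia. Qed.

Lemma odd_ord_pred (j : 'I_(2 * m)) : odd (ord_pred j) = ~~ odd j.
Proof. by rewrite -[in RHS](ord_predK j) odd_ordS negbK. Qed.

(** In this and the next three lemmas, a vertical step between an even row and the odd row above it
    stays inside a pair; the other vertical steps change pair and bring a factor [z] or its
    inverse. *)
Lemma half_ordS_even (j : 'I_(2 * m)) : ~~ odd j -> (ordS j)./2 = j./2.
Proof. by rewrite ordS_val; have := ltn_ord j; case: eqP; lia. Qed.

Lemma half_ord_pred_odd (j : 'I_(2 * m)) : odd j -> (ord_pred j)./2 = j./2.
Proof. by rewrite ord_pred_val; case: eqP; lia. Qed.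

Lemma half_ordS_odd (z : C) (j : 'I_(2 * m)) : z ^+ m = 1 -> odd j ->
  z ^+ (ordS j)./2 = z * z ^+ j./2.
Proof.
move=> zm oj; rewrite -exprS ordS_val; case: eqP => [jm|_].
  by rewrite (_ : j./2.+1 = m) ?zm//; lia.
by congr (z ^+ _); lia.
Qed.

Lemma half_ord_pred_even (z : C) (j : 'I_(2 * m)) : z != 0 -> z ^+ m = 1 ->
  ~~ odd j -> z ^+ (ord_pred j)./2 = z^-1 * z ^+ j./2.
Proof.
move=> z0 zm oj; rewrite -[in RHS](ord_predK j) half_ordS_odd ?odd_ord_pred//.
by rewrite mulrA mulVf// mul1r.
Qed.

Lemma mode_eigen p x :
  \sum_y mode p y * (toroidal_lattice y x)%:R = (mode_eigenvalue p)%:C * mode p x.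
Proof.
have -> : \sum_y mode p y * (toroidal_lattice y x)%:R =
    \sum_(y | toroidal_lattice y x) mode p y.
  by rewrite [RHS]big_mkcond; apply: eq_bigr => y _; case: ifP; rewrite ?mulr1 ?mulr0.
rewrite sum_toroidal// /neighbours !big_cons big_nil addr0.
case: x => i j; rewrite -[(i, j).2]/j -[(i, j).1]/i.
set w := cis (colfreq p); set z := (cis (rowfreq p))^-1.
have w0 : w != 0 by exact: cis_neq0.
have z0 : z != 0 by rewrite invr_eq0 cis_neq0.
have wn : w ^+ n = 1 by apply: cis_rootangleX; lia.
have zm : z ^+ m = 1 by rewrite exprVn cis_rootangleX ?invr1//; lia.
pose c := 1 + z + w; pose rho := (Rxy (colfreq p) (rowfreq p))%:C.
have cE : 1 + z + w = rho * phase c.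
  by rewrite /rho -norm_structure_factor norm_phase.
(* The conjugate of [c] is obtained by inverting [w] and [z], which have modulus one. *)
have cE' : phase c * (1 + z^-1 + w^-1) = rho.
  rewrite /rho -norm_structure_factor -/z -/w -/c -phase_conj; congr (_ * _).
  by rewrite /c !rmorphD rmorph1/= fmorphV/= !conj_cis.
have wE : (2 * cos (colfreq p))%:C = w + w^-1 by rewrite -cisDV.
have lamE : (mode_eigenvalue p)%:C = w + w^-1 + (-1) ^+ (p.2 : nat) * rho.
  rewrite /mode_eigenvalue rmorphD/= wE.
  by rewrite rmorphM/= rmorphXn/= rmorphN1.
have : (-1) ^+ (p.2 : nat) * (-1) ^+ (p.2 : nat) = 1 :> C.
  by rewrite -signr_odd -expr2 sqrr_sign.
have modeE a b : mode p (a, b) = w ^+ a * z ^+ (b./2) *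
  (if odd b then (-1) ^+ (p.2 : nat) * phase c else 1) by [].
rewrite lamE !modeE; move: ((-1) ^+ _) modeE => s modeE ss.
case: (ifP (odd j)) => oj; rewrite !modeE.
  (* Odd row: the three neighbours in even rows contribute [1 + z + w], and [s * s = 1] restores the
     amplitude [s * phase c]. *)
  rewrite !(unity_ordS i)// !(unity_ord_pred i)// odd_ordS odd_ord_pred oj/=.
  rewrite half_ordS_odd// half_ord_pred_odd//.
  transitivity (w ^+ i * z ^+ j./2 * (1 + z + w + (w + w^-1) * (s * phase c))); first by ring.
  rewrite cE; transitivity (w ^+ i * z ^+ j./2 *
    (s * s * rho * phase c + (w + w^-1) * (s * phase c))).
    by rewrite ss mul1r.
  by ring.
(* Even row: the three neighbours in odd rows contribute the conjugate of [c] times [s * phase c],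
   that is [s * rho]. *)
rewrite !(unity_ordS i)// !(unity_ord_pred i)// odd_ordS odd_ord_pred oj/=.
rewrite half_ordS_even ?oj// half_ord_pred_even ?oj//=.
transitivity (w ^+ i * z ^+ j./2 *
  (w + w^-1 + s * (phase c * (1 + z^-1 + w^-1)))); first by ring.
by rewrite cE'; ring.
Qed.

(** The entries have modulus one, so the inverse acts as the conjugate. The sum splits into two
    character sums, which compare frequencies, and a factor [1 + r], which compares bands. *)
Lemma mode_ortho p q :
  \sum_x mode p x * (mode q x)^-1 = ((2 * n * m)%:R : C) *+ (p == q).
Proof.
have hlt (r : vertex n m) : (r.2./2 < m)%N by have := ltn_ord r.2; lia.
pose r := sublattice_phase p / sublattice_phase q.
pose h (j : nat) : C := (cis (rowfreq q) / cis (rowfreq p)) ^+ j./2 * (if odd j then r else 1).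
transitivity (\sum_(i < n) \sum_(j < 2 * m)
    (cis (colfreq p) / cis (colfreq q)) ^+ i * h j).
  rewrite pair_bigA/=; apply: eq_bigr => -[i j] _ /=.
  rewrite /h /mode /= !exprMn !exprVn; case: ifP => _.
    by rewrite /r; field; rewrite ?expf_neq0 ?cis_neq0//= sublattice_phase_neq0.
  by field; rewrite ?expf_neq0 ?cis_neq0.
rewrite -big_distrlr/= (sum_cis_rootangle R p.1 q.1) sum_ord_double.
under eq_bigr => t _.
  rewrite /h /= odd_double/= doubleK uphalf_double mulr1 -[X in X + _]mulr1 -mulrDr; over.
rewrite -mulr_suml (sum_cis_rootangle R (Ordinal (hlt q)) (Ordinal (hlt p))).
have -> : (p == q) = (p.1 == q.1) && (p.2 == q.2).
  by rewrite -xpair_eqE -!surjective_pairing.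
rewrite (_ : (Ordinal _ == _) = (q.2./2 == p.2./2))//.
have [pq1|pq1] := boolP (p.1 == q.1); last by rewrite /= mulr0n mul0r.
have [pq2|pq2] := boolP (q.2./2 == p.2./2)%N; last first.
  rewrite /= mulr0n mul0r mulr0; case: (p.2 =P q.2) pq2 => [->|_ _]/=.
    by rewrite eqxx.
  by [].
move/eqP: pq1 => pq1; move/eqP: pq2 => pq2.
(* At equal frequencies the phases cancel, so [1 + r] is 2 for equal bands and 0 otherwise. *)
have rE : r = (-1) ^+ (odd p.2 (+) odd q.2).
  rewrite /r /sublattice_phase /colfreq /rowfreq pq1 pq2.
  rewrite -mulf_div divff ?phase_neq0// mulr1 -(signr_odd _ p.2) -(signr_odd _ q.2).
  by case: odd; case: odd; rewrite /= ?invrN ?invr1 ?mulrN1 ?opprK ?mulr1.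
have -> : (p.2 == q.2) = (odd p.2 == odd q.2).
  apply/eqP/eqP => [->//|o].
  by apply/ord_inj; rewrite -(odd_double_half p.2) -(odd_double_half q.2) pq2 o.
rewrite rE !mulr1n !natrM -mulrA; case: (odd p.2); case: (odd q.2) => /=;
  rewrite ?mulr0n ?mulr1n ?expr0 ?expr1; ring.
Qed.

(** Modes with second index [2l] and [2l + 1] share a frequency and carry the two signs of [Rxy]. *)
Lemma energy_toroidal :
  energy R (@toroidal_lattice n m) =
  \sum_(k < n) \sum_(l < m)
   (`|2 * cos (rootangle R n k) + Rxy (rootangle R n k) (rootangle R m l)| +
    `|2 * cos (rootangle R n k) - Rxy (rootangle R n k) (rootangle R m l)|).
Proof.
have nm0 : ((2 * n * m)%:R : C) != 0 by rewrite pnatr_eq0; lia.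
rewrite (energy_eigenvectors nm0 mode_ortho mode_eigen).
rewrite -(pair_bigA _ (fun (k : 'I_n) (q : 'I_(2 * m)) =>
  `|mode_eigenvalue ((k, q) : vertex n m)|))/=.
apply: eq_bigr => k _.
rewrite (sum_ord_double m (fun q : nat => `|2 * cos (rootangle R n k) +
  (-1) ^+ q * Rxy (rootangle R n k) (rootangle R m q./2)|)).
apply: eq_bigr => l _; rewrite -(signr_odd _ l.*2) -(signr_odd _ l.*2.+1)/=.
rewrite odd_double/= mulN1r mul1r doubleK.
by rewrite uphalf_double.
Qed.

End Fourier.

(** * Deleting the wrapping edges *)

Section Deletion.
Variables n m : nat.
Hypotheses (n3 : (3 <= n)%N) (m2 : (2 <= m)%N).
Implicit Types u v : vertex n m.

Lemma toroidal_degree u : (\sum_v toroidal_lattice u v = 5)%N.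
Proof.
have := sum_toroidal n3 m2 (fun=> 1%N) u.
rewrite sum1_size /= => <-; rewrite [RHS]big_mkcond; apply: eq_bigr => v _.
by rewrite toroidal_lattice_sym; case: toroidal_lattice.
Qed.

(** Each deleted ordered pair has its first or its second end in [a], and the torus is 5-regular, so
    each case accounts for at most [5 * #|a|] pairs. *)
Lemma sum_deleted_le (f : rel (vertex n m)) (a : pred (vertex n m)) :
  (forall u v, toroidal_lattice u v -> ~~ f u v -> a u || a v) ->
  (\sum_u \sum_v (toroidal_lattice u v && ~~ f u v) <= 10 * #|a|)%N.
Proof.
move=> fa; have S : (\sum_u \sum_v (a u && toroidal_lattice u v) = 5 * #|a|)%N.
  rewrite mulnC -sum_nat_const [RHS]big_mkcond; apply: eq_bigr => u _.
  rewrite -(toroidal_degree u) unfold_in; case: (a u) => //=.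
  by rewrite big1.
have -> : (10 * #|a| = 5 * #|a| + 5 * #|a|)%N by lia.
rewrite -{1}S -S [X in (_ <= _ + X)%N]exchange_big -big_split.
apply: leq_sum => u _; rewrite -big_split; apply: leq_sum => v _ /=.
rewrite [toroidal_lattice v u]toroidal_lattice_sym.
have := fa u v; case: toroidal_lattice; case: (f u v) => //= /(_ isT isT).
by case: (a u); case: (a v).
Qed.

Definition last_row := [pred u : vertex n m | u.2 == (2 * m).-1 :> nat].
Definition last_col := [pred u : vertex n m | u.1 == n.-1 :> nat].

Lemma card_last_row : #|last_row| = n.
Proof.
have m0 : ((2 * m).-1 < 2 * m)%N by lia.
have lastE : last_row =i [predX 'I_n & pred1 (Ordinal m0)].
  by move=> [i j]; rewrite !inE.
by rewrite (eq_card lastE) [LHS]cardX card_ord card1 muln1.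
Qed.

Lemma card_last_col : #|last_col| = (2 * m)%N.
Proof.
have n0 : (n.-1 < n)%N by lia.
have lastE : last_col =i [predX pred1 (Ordinal n0) & 'I_(2 * m)].
  by move=> [i j]; rewrite !inE andbT.
by rewrite (eq_card lastE) [LHS]cardX card_ord card1 mul1n.
Qed.

Lemma row_wrap_last u v : row_wrap u v || row_wrap v u -> last_row u || last_row v.
Proof. by case/orP => /and3P[_ /eqP E _]; rewrite /= E eqxx ?orbT. Qed.

Lemma energy_cylindrical (R : realType) :
  `|energy R (@toroidal_lattice n m) - energy R (@cylindrical_lattice n m)|
  <= (10 * n)%:R.
Proof.
apply: le_trans (energy_lip _ _ _ _) _; rewrite ?ler_nat.
- exact: toroidal_lattice_sym.
- exact: cylindrical_lattice_sym.
- by move=> u v /andP[].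
apply: leq_trans (@sum_deleted_le _ last_row _) _; last by rewrite card_last_row.
move=> u v tuv.
by rewrite /cylindrical_lattice tuv negbK; exact: row_wrap_last.
Qed.

(** Every deleted edge meets the last row or the last column, whose union has at most [n + 2 * m]
    vertices. *)
Lemma energy_free (R : realType) :
  `|energy R (@toroidal_lattice n m) - energy R (@free_lattice n m)|
  <= (10 * (n + 2 * m))%:R.
Proof.
apply: le_trans (energy_lip _ _ _ _) _; rewrite ?ler_nat.
- exact: toroidal_lattice_sym.
- exact: free_lattice_sym.
- by move=> u v /andP[/andP[]].
apply: (@leq_trans (10 * #|[predU last_row & last_col]|)).
  apply: sum_deleted_le => u v tuv.
  rewrite /free_lattice /cylindrical_lattice tuv /= negb_and !negbK.
  rewrite /= !inE; case/orP => [/row_wrap_last/orP[] /= ->|]; rewrite ?orbT//.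
  by case/orP => /andP[/eqP-> _]; rewrite eqxx ?orbT.
by rewrite leq_mul2l/= -[leqRHS](congr2 addn card_last_row card_last_col) -cardUI leq_addr.
Qed.

End Deletion.

(** * Passage to the joint limit *)

Section Limit.
Variable R : realType.

Lemma cvg_filter_prod (u : nat -> nat -> R) (l : R) :
  (forall e : R, 0 < e -> exists N, forall n m, (N <= n)%N -> (N <= m)%N ->
    `|u n m - l| <= e) ->
  u p.1 p.2 @[p --> filter_prod \oo \oo] --> l.
Proof.
move=> ul; apply/cvgrPdist_le => e e0; have [N uN] := ul e e0.
exists ([set n | (N <= n)%N], [set n | (N <= n)%N]).
  by split; exact: nbhs_infty_ge.
by move=> [n m] /= [nN mN]; rewrite distrC; exact: uN.
Qed.

Definition spectral_density (x y : R) : R :=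
  `|2 * cos x + Rxy x y| + `|2 * cos x - Rxy x y|.

Lemma spectral_density_unif (e : R) : 0 < e -> exists2 d : R, 0 < d &
  forall x y x' y', `|x - x'| <= d -> `|y - y'| <= d ->
    `|spectral_density x y - spectral_density x' y'| <= e.
Proof.
(* The first bound keeps the change of [2 * cos x] below [e / 4]; the second keeps that of the
   radicand, at most [8 * d], below [(e / 4) ^+ 2]. *)
move=> e0; pose d := Num.min (e / 8) ((e / 4) ^+ 2 / 8).
have [de de2] : d <= e / 8 /\ d <= (e / 4) ^+ 2 / 8.
  by split; rewrite ge_min lexx ?orbT.
exists d; first by rewrite lt_min !divr_gt0// exprn_gt0// divr_gt0.
move=> x y x' y' xx' yy'.
have cx : `|cos x - cos x'| <= d by apply: le_trans (cos_lip _ _) _.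
have cy : `|cos y - cos y'| <= d by apply: le_trans (cos_lip _ _) _.
have cxy : `|cos (x + y) - cos (x' + y')| <= d + d.
  apply: le_trans (cos_lip _ _) _; rewrite opprD addrACA.
  by apply: le_trans (ler_normD _ _) (lerD _ _).
have dR : `|Rxy x y - Rxy x' y'| <= e / 4.
  apply: dist_sqrt_le; rewrite ?radicand_ge0//; first by rewrite divr_ge0// ltW.
  move: cx cy cxy; rewrite !ler_norml => /andP[c1 c2] /andP[c3 c4] /andP[c5 c6].
  by apply/andP; split; lra.
have {}cx : `|2 * cos x - 2 * cos x'| <= e / 4.
  by move: cx; rewrite !ler_norml => /andP[c1 c2]; apply/andP; split; lra.
rewrite /spectral_density opprD addrACA.
have -> : e = (e / 4 + e / 4) + (e / 4 + e / 4) by lra.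
rewrite !ler_norml in cx dR; move: cx dR => /andP[c1 c2] /andP[c3 c4].
apply: le_trans (ler_normD _ _) (lerD _ _);
  apply: le_trans (ler_dist_dist _ _) _; rewrite ler_norml; apply/andP; split; lra.
Qed.

Notation mu := (@lebesgue_measure R).

Definition limit_energy : R := (8 * pi ^+ 2)^-1 *
  \int[mu]_(y in `[0, 2 * pi]) \int[mu]_(x in `[0, 2 * pi]) spectral_density x y.

Lemma toroidal_limit (e : R) : 0 < e -> exists N, forall n m,
  (N <= n)%N -> (N <= m)%N ->
  `|energy R (@toroidal_lattice n m) / (2 * n * m)%:R - limit_energy| <= e.
Proof.
move=> e0; have p0 := pi_gt0 R.
have L0 : 0 < 2 * pi :> R by rewrite mulr_gt0.
have c0 : 0 < 8 * pi ^+ 2 :> R by rewrite mulr_gt0// exprn_gt0.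
have [N SN] := dist_double_Riemann_sum L0 spectral_density_unif (mulr_gt0 c0 e0).
exists (maxn 3 N) => n m; rewrite !geq_max => /andP[n3 nN] /andP[m3 mN].
rewrite energy_toroidal//; last exact: ltnW.
have {SN} := SN n m nN mN.
set S := \sum_(k < n) _; set J := \int[mu]_(y in _) _ => SJ.
rewrite -[X in `|X / _ - _|]/S /limit_energy -/J.
have n0 : n%:R != 0 :> R by rewrite pnatr_eq0; lia.
have m0 : m%:R != 0 :> R by rewrite pnatr_eq0; lia.
(* The cell area [4 * pi ^+ 2 / (n * m)] divided by [8 * pi ^+ 2] is the weight [1 / (2 * n * m)] of
   a vertex. *)
have rescale (P I T x y : R) : P != 0 -> x != 0 -> y != 0 ->
    T / (2 * x * y) - (8 * P ^+ 2)^-1 * I =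
    - ((8 * P ^+ 2)^-1 * (I - 2 * P / x * (2 * P / y) * T)).
  by move=> P0 x0 y0; field; rewrite P0 x0 y0.
rewrite !natrM rescale ?(gt_eqF p0)//.
by rewrite normrN normrM gtr0_norm ?invr_gt0// ler_pdivrMl.
Qed.

(** Treats the three boundary conditions at once, the torus being its own trivial perturbation. *)
Lemma perturbed_limit (S : forall n m, rel (vertex n m)) :
  (forall n m, (3 <= n)%N -> (2 <= m)%N ->
    `|energy R (@toroidal_lattice n m) - energy R (S n m)| <= (10 * (n + 2 * m))%:R) ->
  energy R (S p.1 p.2) / (2 * p.1 * p.2)%:R @[p --> filter_prod \oo \oo] -->
    limit_energy.
Proof.
move=> St; apply: (@cvg_filter_prod (fun n m => energy R (S n m) / (2 * n * m)%:R)).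
move=> e e0; have [N tN] := toroidal_limit (divr_gt0 e0 (ltr0Sn R 1)).
(* The goal becomes [10 * n + 20 * m <= e * n * m]; with [30 <= m * e] and [30 <= n * e], the two
   terms take one third and two thirds of the right-hand side. *)
pose M := (Num.truncn (30 / e)).+1; exists (maxn 3 (maxn N M)) => n m.
rewrite !geq_max => /and3P[n3 nN nM] /and3P[m3 mN mM].
have H k : (M <= k)%N -> 30 <= k%:R * e.
  move=> Mk; rewrite -ler_pdivrMr//; apply: le_trans (ltW (truncnS_gt _)) _.
  by rewrite ler_nat.
have c0 : 0 < (2 * n * m)%:R :> R by rewrite ltr0n; lia.
have n0 : 0 < n%:R :> R by rewrite ltr0n; lia.
have m0 : 0 < m%:R :> R by rewrite ltr0n; lia.
rewrite (splitr e) -(subrKA (energy R (@toroidal_lattice n m) / (2 * n * m)%:R)).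
apply: le_trans (ler_normD _ _) (lerD _ (tN _ _ nN mN)).
rewrite -mulrBl normrM distrC [X in _ * X]gtr0_norm ?invr_gt0// ler_pdivrMr//.
apply: le_trans (St _ _ n3 (ltnW m3)) _.
rewrite !natrM natrD natrM.
have := ler_wpM2r (ltW n0) (H _ mM); have := ler_wpM2r (ltW m0) (H _ nM).
lra.
Qed.

End Limit.

Theorem theorem2p9 (R : realType) :
  let mu := @lebesgue_measure R in
  let limit : R :=
    (8 * pi ^+ 2)^-1 *
    \int[mu]_(y in `[0, 2 * pi]) \int[mu]_(x in `[0, 2 * pi])
      (`|2 * cos x + Rxy x y| + `|2 * cos x - Rxy x y|) in
  let per_vertex (S : forall n m : nat, rel (vertex n m)) (p : nat * nat) : R :=
    energy R (S p.1 p.2) / (2 * p.1 * p.2)%:R in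
  [/\ per_vertex toroidal_lattice p @[p --> filter_prod \oo \oo] --> limit,
      per_vertex cylindrical_lattice p @[p --> filter_prod \oo \oo] --> limit
    & per_vertex free_lattice p @[p --> filter_prod \oo \oo] --> limit].
Proof.
move=> mu limit per_vertex; split.
- apply: (@perturbed_limit R toroidal_lattice) => n m _ _.
  by rewrite subrr normr0.
- apply: (@perturbed_limit R cylindrical_lattice) => n m n3 m2.
  by apply: le_trans (energy_cylindrical n3 m2 R) _; rewrite ler_nat; lia.
- apply: (@perturbed_limit R free_lattice) => n m n3 m2.
  exact: energy_free.
Qed.
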